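(* Let $K\subset\mathbb R^l$ be compact and let $\mu$ be the Lebesgue measure on the Borel $\sigma$-algebra of $K$. Let $(\rho_n)$ be a sequence of $\mu$-continuous homogeneous Young measures with respective densities $u_n$ (with respect to $\mu$). Then the sequence $(u_n)$ is weakly convergent in $L^1(K)=L^1(K,\mu)$ to some function $h$ if and only if the sequence $(\rho_n)$ is weakly convergent in the Banach space $(\mathrm{rca}(K),\|\cdot\|_{\mathrm{rca}(K)})$ to a homogeneous Young measure $\eta$ with density $h$.
   Context: $\mathrm{rca}(K)$ is the Banach space of regular countably additive scalar measures on the Borel $\sigma$-algebra $\mathcal B(K)$ with the total variation norm $\|m\|_{\mathrm{rca}(K)}=|m|(K)$. Let $\Omega\subset\mathbb R^d$ be a nonempty bounded open set. A Young measure is a weakly$^\ast$-measurable, essentially bounded map $\Omega\to\mathrm{rca}(K)$ whose values are probability measures on $K$; it is homogeneous if it is constant on $\Omega$, and then it is identified with the single probability measure on $K$ that is its value. A measure $\rho$ is $\mu$-continuous if $\mu(A)=0$ implies $\rho(A)=0$; $w$ is a density of $\rho$ (with respect to $\mu$) if $\rho(A)=\int_A w\,d\mu$ for all $A\in\mathcal B(K)$. Weak convergence is convergence in the weak topology of the respective Banach space. *)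

(* Defs.v *)
From HB Require Import structures.
From mathcomp Require Import all_boot all_order all_algebra.
From mathcomp Require Import all_classical all_reals all_analysis.
From mathcomp Require Import measurable_realfun ring lra.
Set Implicit Arguments.
Unset Strict Implicit.
Unset Printing Implicit Defensive.
Import Order.TTheory GRing.Theory Num.Theory.
Import numFieldNormedType.Exports.
Local Open Scope classical_set_scope.
Local Open Scope ring_scope.

Section weak_topology.
Context (R : realType) (V : normedModType R).

Definition dual := {f : {linear V -> R^o} | continuous f}.

(* The coarsest topology making every continuous linear functional continuous. *)
Definition weak_topology := sup_topology
  (fun f : dual => Topological.class (initial_topology (sval f : V -> R^o))).

HB.instance Definition _ := Topological.on weak_topology.

Definition weakly_cvg (u : nat -> V) (l : V) :=
  (u : nat -> weak_topology) @ \oo --> (l : weak_topology).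

Lemma weakly_cvgP (u : nat -> V) (l : V) :
  weakly_cvg u l <->
  forall f : {linear V -> R^o}, continuous f -> (f \o u) @ \oo --> f l.
Proof.
rewrite /weakly_cvg cvg_sup; split => [H f cf | H [f cf]].
  have := H (exist _ f cf) => /= h.
  apply: (cvg_comp _ _ h).
  exact: (@initial_continuous _ _ (f : V -> R^o) l).
move=> A; rewrite (@nbhsE (initial_topology (f : V -> R^o))) => -[B [[C oC CB] Bl] BA].
have /(H f cf) Cfl : nbhs (f l) C.
  by apply: open_nbhs_nbhs; split => //; move: Bl; rewrite -CB.
have {}Cfl : \forall n \near \oo, C (f (u n)) := Cfl.
suff : \forall n \near \oo, A (u n) by [].
by apply: filterS Cfl => n /= Cn; apply: BA; rewrite -CB.
Qed.

End weak_topology.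

Definition borel (X : ptopologicalType) := g_sigma_algebraType (@open X).
HB.instance Definition _ (X : ptopologicalType) := Measurable.on (borel X).

Lemma borel_open (X : ptopologicalType) (U : set X) :
  open U -> measurable (U : set (borel X)).
Proof. by move=> oU; apply: sub_sigma_algebra. Qed.

Lemma borel_closed (X : ptopologicalType) (U : set X) :
  closed U -> measurable (U : set (borel X)).
Proof.
move=> cU; rewrite -[U]setCK; apply: (@measurableC _ (borel X)).
by apply: borel_open; exact: closed_openC.
Qed.

Section rca.
Context (R : realType) (X : ptopologicalType).
Implicit Type m : set (borel X) -> R.

(* Regularity in the sense of Dunford and Schwartz (Linear Operators I,
   III.5.11); the condition on all Borel C in G `\` F says that the total
   variation of G `\` F is arbitrarily small. *)
Definition regular m := forall A : set (borel X), measurable A -> forall e : R, 0 < e ->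
  exists F G : set X, [/\ closed F, open G, F `<=` A, A `<=` G &
    forall C : set (borel X), measurable C -> C `<=` G `\` F -> `|m C| < e].

(* The scalars are real. A set function in Rocq is also defined on the non-Borel
   subsets: it is required to vanish there, so that a measure on the Borel sets
   is represented by exactly one set function and the total variation is a norm
   (not only a seminorm). *)
Definition is_rca : {pred set (borel X) -> R} := mem [set m |
  [/\ forall A, ~ measurable A -> m A = 0, m set0 = 0,
      semi_sigma_additive (fun A => (m A)%:E) & regular m]].

Record rca := Rca { rca_fun :> set (borel X) -> R ; _ : rca_fun \in is_rca }.

HB.instance Definition _ := [isSub for rca_fun].
HB.instance Definition _ := [Choice of rca by <:].

Lemma is_rca_submod_closed : submod_closed is_rca.
Proof.
split.
  rewrite inE; split => //.
  - move=> F _ _ _; rewrite (_ : (fun n => _) = cst 0%E); first exact: cvg_cst.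
    by apply/funext => n; rewrite big1.
  - move=> A mA e e0; exists set0, setT; split => //.
    + exact: closed0.
    + exact: openT.
    + by move=> C _ _ ; rewrite normr0.
move=> a m1 m2; rewrite !inE => -[n1 z1 s1 r1] [n2 z2 s2 r2]; split.
- by move=> A nA; rewrite !fctE n1 // n2 // scaler0 addr0.
- by rewrite !fctE z1 z2 scaler0 addr0.
- move=> F mF tF mUF.
  have h1 := s1 F mF tF mUF; have h2 := s2 F mF tF mUF.
  rewrite (_ : (fun n => _) = (fun n => a%:E * (\sum_(0 <= i < n) (m1 (F i))%:E)
     + (\sum_(0 <= i < n) (m2 (F i))%:E))%E); last first.
    by apply/funext => n; rewrite !sumEFin -EFinM -EFinD mulr_sumr -big_split.
  rewrite [X in _ --> X](_ : _ = (a%:E * (m1 (\bigcup_n F n))%:E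
     + (m2 (\bigcup_n F n))%:E)%E)//.
  apply: cvgeD => //; exact: cvgeZl.
- move=> A mA e e0.
  have e1 : 0 < e / 2 / (`|a| + 1) by rewrite !divr_gt0 // ltr_wpDl.
  have [F1 [G1 [cF1 oG1 FA1 AG1 H1]]] := r1 A mA _ e1.
  have e2 : 0 < e / 2 by rewrite divr_gt0.
  have [F2 [G2 [cF2 oG2 FA2 AG2 H2]]] := r2 A mA _ e2.
  exists (F1 `|` F2), (G1 `&` G2); split.
  + exact: closedU.
  + exact: openI.
  + by rewrite subUset.
  + by rewrite subsetI.
  + move=> C mC CGF.
    have h1 : `|m1 C| < e / 2 / (`|a| + 1).
      by apply: H1 => // x /CGF [[? _] /not_orP[? _]].
    have h2 : `|m2 C| < e / 2 by apply: H2 => // x /CGF [[_ ?] /not_orP[_ ?]].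
    rewrite [X in `|X|](_ : _ = a * m1 C + m2 C)//.
    rewrite (le_lt_trans (ler_normD _ _))// [ltRHS](splitr e) ler_ltD// normrM.
    rewrite (@le_trans _ _ ((`|a| + 1) * (e / 2 / (`|a| + 1))))//.
      by rewrite ler_pM // ?lerDl// ltW.
    by rewrite mulrC divfK// gt_eqF// ltr_wpDl.
Qed.

HB.instance Definition _ := GRing.isSubmodClosed.Build _ _ is_rca
  is_rca_submod_closed.
HB.instance Definition _ := [SubChoice_isSubLmodule of rca by <:].

Definition rca_charge (m : rca) (A : set (borel X)) : \bar R := (m A)%:E.

Lemma rcaP (m : rca) : [/\ forall A, ~ measurable A -> m A = 0, m set0 = 0,
  semi_sigma_additive (rca_charge m) & regular m].
Proof. by case: m => m mP; have h := mP; rewrite inE in h. Qed.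

Section charge.
Variable m : rca.
Let rca_charge0 : rca_charge m set0 = 0%E.
Proof. by case: (rcaP m) => _ m0 _ _; rewrite /rca_charge m0. Qed.
Let rca_charge_fin A : measurable A -> rca_charge m A \is a fin_num.
Proof. by []. Qed.
Let rca_charge_sigma : semi_sigma_additive (rca_charge m).
Proof. by case: (rcaP m). Qed.
HB.instance Definition _ := isCharge.Build _ _ _ (rca_charge m)
  rca_charge0 rca_charge_fin rca_charge_sigma.
End charge.

Lemma rca_hahn (m : rca) :
  exists PN : set (borel X) * set (borel X),
    hahn_decomposition (rca_charge m) PN.1 PN.2.
Proof. by have [P [N h]] := Hahn_decomposition (rca_charge m); exists (P, N). Qed.

(* The value on Borel sets does not depend on the Hahn decomposition chosen. *)
Definition total_variation (m : rca) : set (borel X) -> \bar R :=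
  charge_variation (svalP (cid (rca_hahn m))).

HB.instance Definition _ (m : rca) := Measure.on (total_variation m).

Definition rca_norm (m : rca) : R := fine (total_variation m setT).

Lemma total_variation_fin (m : rca) (A : set (borel X)) : measurable A ->
  total_variation m A \is a fin_num.
Proof. by move=> mA; apply: fin_num_measure. Qed.

Lemma le_total_variation (m : rca) (A : set (borel X)) : measurable A ->
  (`|m A|%:E <= total_variation m A)%E.
Proof.
move=> mA; exact: (abse_charge_variation (svalP (cid (rca_hahn m))) mA).
Qed.

Lemma total_variationD (m : rca) (A B : set (borel X)) :
  measurable A -> measurable B -> A `|` B = setT -> A `&` B = set0 ->
  `|m A| + `|m B| <= rca_norm m.
Proof.
move=> mA mB AB AB0.
rewrite -lee_fin /rca_norm fineK ?total_variation_fin// -AB measureU//.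
by rewrite EFinD leeD // le_total_variation.
Qed.

Lemma rca_normE (m : rca) : exists A B, [/\ measurable A, measurable B,
  A `|` B = setT, A `&` B = set0 & rca_norm m = m A - m B].
Proof.
rewrite /rca_norm /total_variation; case: cid => -[P N] /= PN.
have [[mP _] [mN _] PNT PN0] := PN.
exists P, N; split => //.
rewrite /charge_variation /= jordan_posE jordan_negE cjordan_posE cjordan_negE.
rewrite /crestr0 mem_set//= /crestr/=.
by rewrite !setTI.
Qed.

Lemma rca_norm_ge0 (m : rca) : 0 <= rca_norm m.
Proof. exact: fine_ge0. Qed.

Lemma ler_rca_normD (m1 m2 : rca) :
  rca_norm (m1 + m2) <= rca_norm m1 + rca_norm m2.
Proof.
have [A [B [mA mB AB AB0 ->]]] := rca_normE (m1 + m2).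
have := total_variationD m1 mA mB AB AB0.
have := total_variationD m2 mA mB AB AB0.
rewrite -[(m1 + m2) A]/(m1 A + m2 A) -[(m1 + m2) B]/(m1 B + m2 B).
have := ler_norm (m1 A); have := ler_norm (m2 A).
have := ler_norm (- m1 B); have := ler_norm (- m2 B); rewrite !normrN.
lra.
Qed.

Lemma rca_normZ (a : R) (m : rca) : rca_norm (a *: m) = `|a| * rca_norm m.
Proof.
have H (b : R) (n : rca) : rca_norm (b *: n) <= `|b| * rca_norm n.
  have [A [B [mA mB AB AB0 ->]]] := rca_normE (b *: n).
  apply: le_trans (ler_wpM2l (normr_ge0 b) (total_variationD n mA mB AB AB0)).
  rewrite -[(b *: n) A]/(b * n A) -[(b *: n) B]/(b * n B) mulrDr -!normrM.
  by rewrite -[X in _ <= _ + X]normrN lerD// ler_norm.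
apply/eqP; rewrite eq_le H/=.
have [->|a0] := eqVneq a 0; first by rewrite normr0 mul0r rca_norm_ge0.
rewrite -ler_pdivlMl ?normr_gt0// -normfV.
by apply: le_trans (H _ _); rewrite scalerA mulVf// scale1r.
Qed.

Lemma rca_norm_eq0 (m : rca) : rca_norm m = 0 -> m = 0.
Proof.
move=> m0; apply/val_inj/funext => A.
have [mA|nA] := pselect (measurable A); last first.
  by have [h _ _ _] := rcaP m; have [h0 _ _ _] := rcaP 0; rewrite /= h// h0.
apply/eqP; rewrite -normr_le0 -lee_fin (le_trans (le_total_variation m mA))//.
rewrite -[X in (_ <= X%:E)%E]m0 /rca_norm fineK; last exact: total_variation_fin.
by rewrite le_measure ?inE.
Qed.

HB.instance Definition _ :=
  Lmodule_isNormed.Build R rca ler_rca_normD rca_normZ rca_norm_eq0.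
End rca.

(* The normed space structure of L^1 on the type LspaceType1 mu of classes of
   integrable functions modulo almost everywhere equality. The coercion of a
   class to a function selects a representative, hence the operations below are
   characterized by the almost everywhere equalities L1_addE, L1_scaleE, ... *)
Section L1.
Local Lemma filterS4 (U : Type) (F : set_system U) : Filter F ->
  forall P Q S W Z : set U, (forall x, P x -> Q x -> S x -> W x -> Z x) ->
  F P -> F Q -> F S -> F W -> F Z.
Proof.
move=> FF P Q S W Z H FP FQ FS.
by apply: filterS2 (filterI FP (filterI FQ FS)) => x [? []]; exact: H.
Qed.
Context d (T : measurableType d) (R : realType) (mu : {measure set T -> \bar R}).
Local Notation L1 := (LspaceType1 mu).
Local Notation Lfun1 := (LfunType mu (lexx 1%E)).
Local Notation Mfun := {mfun_ mu, T >-> measurableTypeR R}.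

HB.instance Definition _ := gen_eqMixin L1.
HB.instance Definition _ := gen_choiceMixin L1.

Lemma L1_measurable (F : L1) : measurable_fun setT (F : T -> R).
Proof. exact: (@measurable_funPT _ _ _ _ (repr (F : Mfun))). Qed.

Lemma eq_L1 (F G : L1) : F = G :> Mfun -> F = G.
Proof.
move: F G => [F [[hF]]] [G [[hG]]] /= FG; move: FG hF hG => -> hF hG.
by rewrite (Prop_irrelevance hF hG).
Qed.

Lemma L1_eqP (F G : L1) : F = G <-> (F : T -> R) = G %[ae mu].
Proof.
split=> [->|FG]; first exact: ae_eq_refl.
by apply: eq_L1; rewrite -[F : Mfun]reprK -[G : Mfun]reprK; apply/eqmodP/asboolP.
Qed.

Lemma L1_in (F : L1) : (F : T -> R) \in Lfun mu 1.
Proof.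
apply/andP; split; first by rewrite inE/=; exact: L1_measurable.
rewrite inE /=; exact: Lebesgue_finite.
Qed.

Definition Lfun_of_L1 (F : L1) : Lfun1 := Lfun_Sub (lexx 1%E) (L1_in F).

Section L1_of.
Variable f : Lfun1.
Let fmeas : measurable_fun [set: T] (f : T -> measurableTypeR R).
Proof. exact: (@measurable_funPT _ _ _ _ f). Qed.
HB.instance Definition fm := isMeasurableFun.Build _ _ _ (measurableTypeR R)
  (f : T -> measurableTypeR R) fmeas.
Let f' : {mfun T >-> measurableTypeR R} := MeasurableFun.Pack (MeasurableFun.Class fm).
Let c : Mfun := (\pi_Mfun f')%qT.

Let c_ae : (c : T -> R) = f %[ae mu].
Proof.
have : (repr c == f' %[mod Mfun])%qT by rewrite reprK.
by rewrite eqmodE => /asboolP.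
Qed.

Let c_fin : finite_norm mu 1 c.
Proof.
have : finite_norm mu 1 f by exact: Lfunction_finite.
rewrite /finite_norm !Lnorm1.
rewrite (ae_eq_integral (fun x => `|(EFin \o c) x|%E))//=.
- by apply/measurable_EFinP/measurableT_comp.
- apply/measurable_EFinP/measurableT_comp => //.
- by apply: filterS c_ae => x h _; rewrite h.
Qed.
HB.instance Definition _ := isFinLebesgue.Build d T R mu 1%E (lexx 1%E) c c_fin.

Definition L1_of : L1 := c.
Lemma L1_ofE : (L1_of : T -> R) = f %[ae mu].
Proof. exact: c_ae. Qed.
End L1_of.

Definition L1_zero : L1 := L1_of 0.
Definition L1_opp (F : L1) : L1 := L1_of (- Lfun_of_L1 F).
Definition L1_add (F G : L1) : L1 := L1_of (Lfun_of_L1 F + Lfun_of_L1 G).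
Definition L1_scale (a : R) (F : L1) : L1 := L1_of (a *: Lfun_of_L1 F).

Lemma L1_zeroE : (L1_zero : T -> R) = cst 0 %[ae mu].
Proof. exact: L1_ofE. Qed.
Lemma L1_oppE F : (L1_opp F : T -> R) = (fun x => - F x) %[ae mu].
Proof. exact: L1_ofE. Qed.
Lemma L1_addE F G : (L1_add F G : T -> R) = (fun x => F x + G x) %[ae mu].
Proof. exact: L1_ofE. Qed.
Lemma L1_scaleE a F : (L1_scale a F : T -> R) = (fun x => a * F x) %[ae mu].
Proof. exact: L1_ofE. Qed.

Let addA : associative L1_add.
Proof.
move=> F G H; apply/L1_eqP; move: (L1_addE F (L1_add G H)) (L1_addE G H)
  (L1_addE (L1_add F G) H) (L1_addE F G).
by apply: filterS4 => x + + + + _ => -> // -> // -> // -> //; rewrite addrA.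
Qed.

Let addC : commutative L1_add.
Proof.
move=> F G; apply/L1_eqP; move: (L1_addE F G) (L1_addE G F).
by apply: filterS2 => x + + _ => -> // -> //; rewrite addrC.
Qed.

Let add0 : left_id L1_zero L1_add.
Proof.
move=> F; apply/L1_eqP; move: (L1_addE L1_zero F) L1_zeroE.
by apply: filterS2 => x + + _ => -> // -> //; rewrite add0r.
Qed.

Let addN : left_inverse L1_zero L1_opp L1_add.
Proof.
move=> F; apply/L1_eqP; move: (L1_addE (L1_opp F) F) (L1_oppE F) L1_zeroE.
by apply: filterS3 => x + + + _ => -> // -> // -> //; rewrite addNr.
Qed.

HB.instance Definition _ := GRing.isZmodule.Build L1 addA addC add0 addN.

Let scaleA a b (F : L1) : L1_scale a (L1_scale b F) = L1_scale (a * b) F.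
Proof.
apply/L1_eqP; move: (L1_scaleE a (L1_scale b F)) (L1_scaleE b F)
  (L1_scaleE (a * b) F).
by apply: filterS3 => x + + + _ => -> // -> // -> //; rewrite mulrA.
Qed.

Let scale1 : left_id 1 L1_scale.
Proof.
move=> F; apply/L1_eqP; move: (L1_scaleE 1 F).
by apply: filterS => x + _ => -> //; rewrite mul1r.
Qed.

Let scaleDr : right_distributive L1_scale +%R.
Proof.
move=> a F G; apply/L1_eqP.
have [h1 h2 h3 h4] := And4 (L1_scaleE a (L1_add F G)) (L1_addE F G)
  (L1_scaleE a F) (L1_scaleE a G).
have h5 := L1_addE (L1_scale a F) (L1_scale a G).
near=> x => _.
rewrite -[LHS]/(L1_scale a (L1_add F G) x).
rewrite -[RHS]/(L1_add (L1_scale a F) (L1_scale a G) x).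
rewrite (near h1 x _) // (near h2 x _) // (near h5 x _) //.
by rewrite (near h3 x _) // (near h4 x _) // mulrDr.
Unshelve. all: by end_near. Qed.

Let scaleDl (F : L1) : {morph L1_scale^~ F : a b / a + b}.
Proof.
move=> a b; apply/L1_eqP; move: (L1_scaleE (a + b) F) (L1_scaleE a F)
  (L1_scaleE b F) (L1_addE (L1_scale a F) (L1_scale b F)).
by apply: filterS4 => x + + + + _ => -> // h1 h2 -> //; rewrite h1 // h2 // mulrDl.
Qed.

HB.instance Definition _ := GRing.Zmodule_isLmodule.Build R L1
  scaleA scale1 scaleDr scaleDl.

Definition L1_norm (F : L1) : R := fine ('N[mu]_1 [EFin \o F])%E.

Lemma L1_norm_ae (F : L1) (f : Lfun1) : (F : T -> R) = f %[ae mu] ->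
  L1_norm F = fine ('N[mu]_1 [EFin \o f])%E.
Proof.
move=> Ff; congr fine; rewrite !Lnorm1; apply: ae_eq_integral => //=.
- by apply/measurable_EFinP/measurableT_comp => //; exact: L1_measurable.
- by apply/measurable_EFinP/measurableT_comp.
- by apply: filterS Ff => x h _; rewrite h.
Qed.

Lemma ler_L1_normD (F G : L1) : L1_norm (F + G) <= L1_norm F + L1_norm G.
Proof.
rewrite (@L1_norm_ae (F + G) (Lfun_of_L1 F + Lfun_of_L1 G) (L1_addE F G)).
exact: ler_LnormD.
Qed.

Lemma L1_normZ a (F : L1) : L1_norm (a *: F) = `|a| * L1_norm F.
Proof.
rewrite (@L1_norm_ae (a *: F) (a *: Lfun_of_L1 F) (L1_scaleE a F)).
by have := LnormZ (Lfun_of_L1 F) a => /(congr1 fine);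
  rewrite -(finite_norm_fine (Lfun_of_L1 F)).
Qed.

Lemma L1_norm_eq0 (F : L1) : L1_norm F = 0 -> F = 0.
Proof.
move=> /(@fine_Lnormr_eq0 _ _ _ mu 1%E (lexx 1%E) (Lfun_of_L1 F)) F0.
apply/L1_eqP; move: F0 L1_zeroE.
by apply: filterS2 => x h1 h2 _; rewrite [LHS](h1 I) [RHS](h2 I).
Qed.

HB.instance Definition _ :=
  Lmodule_isNormed.Build R L1 ler_L1_normD L1_normZ L1_norm_eq0.
End L1.
Lemma borel_continuous (X Y : ptopologicalType) (f : X -> Y) : continuous f ->
  measurable_fun setT (f : borel X -> borel Y).
Proof.
move=> /continuousP cf; apply: (@measurability _ _ (borel X) (borel Y) setT f open) => //.
by move=> _ [U oU <-]; rewrite setTI; apply: borel_open; exact: cf.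
Qed.

Lemma borel_continuousR (R : realType) (X : ptopologicalType) (f : X -> R) :
  continuous f -> measurable_fun setT (f : borel X -> R).
Proof.
move=> /continuousP cf.
apply: (measurability _ (RGenOpens.measurableE R)) => _ [_ [a [b ->]] <-].
by rewrite setTI; apply: borel_open; apply: cf; exact: interval_open.
Qed.

Lemma open_measurable_prod (R : realType) (X : ptopologicalType)
    (O : set (R * X)) : open O -> measurable (O : set (R * borel X)).
Proof.
move=> oO.
pose V (q : rat * rat) := \bigcup_(W in [set W | open W /\
  `]ratr q.1, ratr q.2[ `*` W `<=` O]) W.
have -> : O = \bigcup_q (`]ratr q.1 : R, ratr q.2[%classic `*` (V q : set (borel X))).
  apply/seteqP; split => [[x v] Oxv|[x v] [q _ [/= xq [W [oW WO] Wv]]]]; last first.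
    exact: WO.
  have : nbhs (x, v) O by exact: open_nbhs_nbhs.
  move=> -[[A B] /= [xA vB] ABO].
  move: xA => /nbhs_ballP [e e0 eA].
  move: vB; rewrite nbhsE => -[W [oW Wv] WB].
  have [p p1] := @rat_in_itvoo R (x - e) x ltac:(by rewrite ltrBlDr ltrDl).
  have [q q1] := @rat_in_itvoo R x (x + e) ltac:(by rewrite ltrDl).
  exists (p, q) => //; split => /=.
    by move: p1 q1; rewrite !in_itv/= => /andP[_ ->] /andP[-> _].
  exists W => //; split => // -[y w] [/= yI Ww].
  apply: ABO; split => /=; last exact: WB.
  apply: eA; rewrite /ball/=; move: yI p1 q1; rewrite !in_itv/=.
  move=> /andP[py yq] /andP[ep _] /andP[_ qe].
  by rewrite ltr_distlC; apply/andP; split; [exact: lt_trans py | exact: lt_trans qe].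
apply: countable_bigcupT_measurable => // q; apply: measurableX => //.
by apply: borel_open; apply: bigcup_open => W [].
Qed.

Lemma sigma_finite_prod d1 d2 (T1 : measurableType d1) (T2 : measurableType d2)
    (R : realType) (m1 : {sigma_finite_measure set T1 -> \bar R})
    (m2 : {sigma_finite_measure set T2 -> \bar R}) :
  sigma_finite setT (m1 \x m2)%E.
Proof.
have /sigma_finiteP[F [TF ndF Foo]] := sigma_finiteT m1.
have /sigma_finiteP[G [TG ndG Goo]] := sigma_finiteT m2.
exists (fun n => F n `*` G n).
  rewrite -setXTT TF TG predeqE => -[x y]; split.
    move=> [/= [n _ Fnx] [k _ Gky]]; exists (maxn n k) => //; split.
    - by move: x Fnx; exact/subsetPset/ndF/leq_maxl.
    - by move: y Gky; exact/subsetPset/ndG/leq_maxr.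
  by move=> [n _ []/= ? ?]; split; exists n.
move=> k; have [? ?] := Foo k; have [? ?] := Goo k.
split; first exact: measurableX.
by rewrite product_measure1E// lte_mul_pinfty// ge0_fin_numE.
Qed.

Section lebesgue_rV.
Context (R : realType).

Definition rV_cons n (xv : R * 'rV[R]_n) : 'rV[R]_n.+1 :=
  \row_i (if unlift ord0 i is Some j then xv.2 ord0 j else xv.1).
Definition rV_uncons n (w : 'rV[R]_n.+1) : R * 'rV[R]_n :=
  (w ord0 ord0, \row_j w ord0 (lift ord0 j)).

Lemma rV_cons0 n xv : @rV_cons n xv ord0 ord0 = xv.1.
Proof. by rewrite mxE unlift_none. Qed.

Lemma rV_consS n xv j : @rV_cons n xv ord0 (lift ord0 j) = xv.2 ord0 j.
Proof. by rewrite mxE liftK. Qed.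

Lemma rV_consK n : cancel (@rV_cons n) (@rV_uncons n).
Proof.
move=> [x v]; rewrite /rV_uncons rV_cons0; congr pair.
by apply/rowP => j; rewrite mxE rV_consS.
Qed.

Lemma rV_cons_continuous n : continuous (@rV_cons n).
Proof.
move=> [x v] A /nbhs_ballP [e /= e0 eA].
suff : \forall yw \near (x, v), A (rV_cons yw) by [].
near=> yw; apply: eA; split => // i j; rewrite ord1.
have : ball (x, v) e yw by near: yw; exact: nbhsx_ballx.
case => /= bx bv.
have [->|[k ->]] : j = ord0 \/ exists k, j = lift ord0 k.
  by case: (unliftP ord0 j) => [k ->|->]; [right; exists k|left].
- by rewrite !rV_cons0.
- by rewrite !rV_consS; case: bv => _; exact.
Unshelve. all: by end_near. Qed.

Lemma measurable_rV_cons n :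
  measurable_fun setT (@rV_cons n : R * borel 'rV[R]_n -> borel 'rV[R]_n.+1).
Proof.
apply: (@measurability _ _ _ (borel 'rV[R]_n.+1) setT _ open) => //.
move=> _ [U oU <-]; rewrite setTI; apply: open_measurable_prod.
by move/continuousP : (@rV_cons_continuous n); exact.
Qed.

Lemma measurable_rV_uncons n :
  measurable_fun setT (@rV_uncons n : borel 'rV[R]_n.+1 -> R * borel 'rV[R]_n).
Proof.
apply/measurable_fun_pairP; split.
- apply: (@borel_continuousR R 'rV[R]_n.+1 (fun w => w ord0 ord0)).
  exact: coord_continuous.
- apply: (@borel_continuous 'rV[R]_n.+1 'rV[R]_n
    (fun w => \row_j w ord0 (lift ord0 j))).
  move=> w A /nbhs_ballP [e /= e0 eA]; apply/nbhs_ballP; exists e => //= w' ww'.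
  apply: eA; split => // i j; rewrite !mxE.
  by case: ww' => _; exact.
Qed.

Section cons_measure.
Variables (n : nat) (m : {sigma_finite_measure set (borel 'rV[R]_n) -> \bar R}).

Definition cons_measure : set (borel 'rV[R]_n.+1) -> \bar R :=
  pushforward (@lebesgue_measure R \x m)%E
    (@rV_cons n : R * borel 'rV[R]_n -> borel 'rV[R]_n.+1).

Let cm0 : cons_measure set0 = 0%E.
Proof. by rewrite /cons_measure /pushforward preimage_set0 measure0. Qed.
Let cm_ge0 A : (0 <= cons_measure A)%E.
Proof. by rewrite /cons_measure /pushforward measure_ge0. Qed.
Let cm_sigma : semi_sigma_additive cons_measure.
Proof.
move=> F mF tF mUF; rewrite /cons_measure /pushforward preimage_bigcup.
apply: measure_semi_sigma_additive.
- by move=> k; rewrite -[X in measurable X]setTI; exact: measurable_rV_cons.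
- apply/trivIsetP => /= i j _ _ ij; rewrite -preimage_setI.
  by move/trivIsetP : tF => /(_ _ _ _ _ ij) ->//; rewrite preimage_set0.
- rewrite -preimage_bigcup -[X in measurable X]setTI.
  exact: measurable_rV_cons.
Qed.
HB.instance Definition _ := isMeasure.Build _ _ _ cons_measure cm0 cm_ge0 cm_sigma.

Let cm_sfin : sigma_finite setT cons_measure.
Proof.
have [F FT Ffin] := sigma_finite_prod (@lebesgue_measure R) m.
exists (fun k => @rV_uncons n @^-1` F k).
  by rewrite -preimage_bigcup -FT preimage_setT.
move=> k; have [mF Foo] := Ffin k; split.
  by rewrite -[X in measurable X]setTI; exact: measurable_rV_uncons.
rewrite /cons_measure /pushforward -comp_preimage.
by rewrite (_ : rV_uncons (n:=n) \o _ = id)//; apply/funext => z /=; rewrite rV_consK.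
Qed.
HB.instance Definition _ := Measure_isSigmaFinite.Build _ _ _ cons_measure cm_sfin.
End cons_measure.

(* Lebesgue measure on the Borel sets of R^n, as an iterated product measure:
   R^(n+1) is identified with R * R^n by rV_cons. Cf. lebesgue_rV_box. *)
Fixpoint lebesgue_rV n : {sigma_finite_measure set (borel 'rV[R]_n) -> \bar R} :=
  match n with
  | 0 => dirac (0 : borel 'rV[R]_0)
  | k.+1 => cons_measure (lebesgue_rV k)
  end.
End lebesgue_rV.


Lemma lebesgue_rV_box (R : realType) n (a b : 'rV[R]_n) :
  (forall i, a ord0 i <= b ord0 i) ->
  lebesgue_rV R n [set v | forall i, a ord0 i <= v ord0 i <= b ord0 i] =
  (\prod_i (b ord0 i - a ord0 i))%:E.
Proof.
elim: n a b => [a b _|n IH a b ab] /=.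
  by rewrite big_ord0 diracE mem_set// => -[].
rewrite /cons_measure /pushforward.
pose B := [set v : borel 'rV[R]_n | forall i, (rV_uncons a).2 ord0 i <= v ord0 i
  <= (rV_uncons b).2 ord0 i].
rewrite (_ : _ @^-1` _ = `[a ord0 ord0, b ord0 ord0] `*` B); last first.
  apply/seteqP; split => -[x v] /=.
    move=> h; split => /=; first by have := h ord0; rewrite rV_cons0 in_itv.
    by move=> i; have := h (lift ord0 i); rewrite rV_consS !mxE.
  rewrite in_itv/= => -[h1 h2] i.
  have [->|[k ->]] : i = ord0 \/ exists k, i = lift ord0 k.
    by case: (unliftP ord0 i) => [k ->|->]; [right; exists k|left].
  - by rewrite rV_cons0.
  - by have := h2 k; rewrite rV_consS !mxE.
have mB : measurable B.
  have -> : B = \bigcap_i [set v : 'rV[R]_n | (rV_uncons a).2 ord0 i <= v ord0 i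
      <= (rV_uncons b).2 ord0 i].
    by apply/seteqP; split => [v Bv i _|v Bv i]; exact: Bv.
  apply: fin_bigcap_measurable => // i _; apply: borel_closed.
  rewrite (_ : [set _ | _] = (fun v : 'rV[R]_n => v ord0 i) @^-1`
    `[(rV_uncons a).2 ord0 i, (rV_uncons b).2 ord0 i]); last first.
    by apply/seteqP; split => v /=; rewrite in_itv.
  apply: preimage_closed => //; first by move=> v _; exact: coord_continuous.
  exact: interval_closed.
rewrite product_measure1E// IH; last by move=> i; rewrite !mxE.
rewrite [X in (X * _)%E = _]lebesgue_measure_itv/= lte_fin.
rewrite big_ord_recl EFinM; congr (_ * _)%E.
  have := ab ord0; rewrite le_eqVlt => /predU1P[->|->//].
  by rewrite ltxx subrr.
by congr EFin; apply: eq_bigr => i _; rewrite !mxE.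
Qed.

Section compact_space.
Context (R : realType) (l : nat) (K : set 'rV[R]_l).

(* The compact set K as a topological space (with the subspace topology). The
   library only has sigma-algebras on pointed types, whence the argument K0; its
   only effect is to choose the distinguished point. When K is empty there is no
   probability measure on K, hence no Young measure with values in rca(K). *)
Definition compact_space (cK : compact K) (K0 : K !=set0) : Type := set_type K.

Context (cK : compact K) (K0 : K !=set0).
Local Notation X := (compact_space cK K0).

HB.instance Definition _ := Topological.copy X (set_type K).
HB.instance Definition _ := isPointed.Build X
  (exist _ (sval (cid K0)) (mem_set (svalP (cid K0)))).

Lemma measurable_image_val (A : set (borel X)) : measurable A ->
  measurable (set_val @` A : set (borel 'rV[R]_l)).
Proof.
have mK : measurable (K : set (borel 'rV[R]_l)).
  by apply: borel_closed; apply: compact_closed => //; exact: norm_hausdorff.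
have valK (B : set 'rV[R]_l) : set_val @` (set_val @^-1` B : set X) = B `&` K.
  apply/seteqP; split => [_ [x /= Bx <-]|v [Bv Kv]].
    by split => //; exact: set_mem (valP x).
  by exists (exist _ v (mem_set Kv)).
move: A; apply: smallest_sub; last first.
  by move=> A [B oB <-]; rewrite valK; apply: measurableI => //; exact: borel_open.
split.
- by rewrite image_set0.
- move=> A mA; rewrite setTD.
  rewrite (_ : set_val @` _ = K `\` set_val @` A); first exact: measurableD.
  apply/seteqP; split => [_ [x Ax <-]|v [Kv Av]].
    split; first exact: set_mem (valP x).
    by move=> [y Ay /val_inj yx]; apply: Ax; rewrite -yx.
  exists (exist _ v (mem_set Kv)) => // Ax; apply: Av.
  by exists (exist _ v (mem_set Kv)).
- by move=> F mF; rewrite image_bigcup; exact: bigcup_measurable.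
Qed.

(* The Lebesgue measure of R^l, on the Borel sigma-algebra of K. *)
Definition lebesgue_on : set (borel X) -> \bar R :=
  fun A => lebesgue_rV R l (set_val @` A).

Let lebesgue_on0 : lebesgue_on set0 = 0%E.
Proof. by rewrite /lebesgue_on image_set0 measure0. Qed.
Let lebesgue_on_ge0 A : (0 <= lebesgue_on A)%E.
Proof. exact: measure_ge0. Qed.
Let lebesgue_on_sigma : semi_sigma_additive lebesgue_on.
Proof.
move=> F mF tF mUF; rewrite /lebesgue_on image_bigcup.
apply: measure_semi_sigma_additive.
- by move=> i; exact: measurable_image_val.
- apply/trivIsetP => /= i j _ _ ij; apply/seteqP; split => // v [[x Fx <-]].
  move=> [y Fy /val_inj yx]; move/trivIsetP : tF => /(_ i j I I ij) => FF.
  have : (F i `&` F j) x by split => //; rewrite -yx.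
  by rewrite FF.
- by apply: bigcup_measurable => i _; exact: measurable_image_val.
Qed.
HB.instance Definition _ := isMeasure.Build _ _ _ lebesgue_on
  lebesgue_on0 lebesgue_on_ge0 lebesgue_on_sigma.
End compact_space.
Arguments lebesgue_on {R l K} cK K0 A.

Section young_measure.
Context (R : realType) (d : nat) (X : ptopologicalType) (Omega : set 'rV[R]_d).

(* Integration of a continuous function against a signed measure: the duality
   pairing of C(X) with rca(X). *)
Definition rca_integral (f : X -> R) (m : rca R X) : R :=
  let nuPN := svalP (cid (rca_hahn m)) in
  \int[jordan_pos nuPN]_x f x - \int[jordan_neg nuPN]_x f x.

Definition is_probability (m : rca R X) :=
  exists P : probability (borel X) R, forall A, measurable A -> (m A)%:E = P A.

(* The sigma-algebra of Lebesgue measurable subsets of R^d. *)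
Definition lebesgue_measurableType :=
  caratheodory_type ((lebesgue_rV R d)^*)%mu.

Definition weak_star_measurable (nu : 'rV[R]_d -> rca R X) :=
  forall f : X -> R, continuous f ->
  measurable_fun (Omega : set lebesgue_measurableType)
    (fun w => rca_integral f (nu w)).

Definition essentially_bounded (nu : 'rV[R]_d -> rca R X) :=
  exists C : R, \forall w \ae lebesgue_rV R d, Omega w -> `|nu w| <= C.

Definition young_measure (nu : 'rV[R]_d -> rca R X) :=
  [/\ weak_star_measurable nu, essentially_bounded nu &
      forall w, Omega w -> is_probability (nu w)].

(* m is the value of a Young measure that is constant on Omega; for Omega
   nonempty, homogeneous Young measures are identified with such values. *)
Definition homogeneous_young_measure (m : rca R X) :=
  exists nu, young_measure nu /\ forall w, Omega w -> nu w = m.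

End young_measure.

Definition mu_continuous (R : realType) (X : ptopologicalType)
    (mu : {measure set (borel X) -> \bar R}) (m : rca R X) :=
  content_dominates mu (rca_charge m).

Definition has_density (R : realType) (X : ptopologicalType)
    (mu : {measure set (borel X) -> \bar R}) (m : rca R X) (w : borel X -> R) :=
  forall A, measurable A -> (m A)%:E = (\int[mu]_(x in A) (w x)%:E)%E.

(* Main.v *)
From HB Require Import structures.
Require Import Defs.
From mathcomp Require Import all_boot all_order all_algebra.
From mathcomp Require Import all_classical all_reals all_analysis.
From mathcomp Require Import borel_hierarchy measurable_realfun ring lra.
Import Order.TTheory GRing.Theory Num.Theory.
Import numFieldNormedType.Exports.
Local Open Scope classical_set_scope.
Local Open Scope ring_scope.

(** The map sending a class [w] of integrable functions to the signed measure
[w mu] is a linear isometry of [L^1(K, mu)] into [rca(K)]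
([rca_of_density_isometry]), and having density [w] means being its value at [w]
([has_densityP]). So the two convergences compare a sequence with its image
under a linear isometry, and such a map both preserves and reflects weak
convergence ([weakly_cvg_isometry]). It preserves it because a continuous
functional composed with the isometry is again one; it reflects it because, by
the Hahn-Banach theorem ([hahn_banach]), every continuous functional on the
source is of this form.

Two points are left. The measure [w mu] has to be regular, which holds for every
finite signed Borel measure on a space whose closed sets are countable
intersections of open sets ([regular_charge]), in particular on the metric space
[K] ([closed_Gdelta]). And the limit has to be a Young measure: evaluation at a
Borel set is a continuous functional on [rca(K)], so that the conditions of
being nonnegative and of total mass [1] survive in the weak limit
([weakly_cvg_is_probability]); a constant map with such a value is a Young
measure. *)

(** * The Hahn-Banach theorem and weak convergence *)

Section hahn_banach.
Context {R : realType} {V : normedModType R} (C : R).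
Implicit Type G : set (V * R^o).

(** The graph of a linear form on a subspace of [V], bounded above by [C] times
the norm. Working with graphs rather than with forms on varying subspaces makes
the extension order plain inclusion; the bound at [0] is what makes such a
relation single-valued. The empty set is included. *)
Definition dominated_graph G :=
  (forall (a : R) x y, G x -> G y -> G (a *: x + y)) /\
  (forall x, G x -> x.2 <= C * `|x.1|).

Lemma dominated_graph_fun G v r s :
  dominated_graph G -> G (v, r) -> G (v, s) -> r = s.
Proof.
move=> [Glin Gdom].
have le r1 r2 : G (v, r1) -> G (v, r2) -> r1 <= r2.
  move=> G1 G2; have := Gdom _ (Glin (-1) _ _ G2 G1).
  rewrite /= -[-1 *: r2]/(-1 * r2) scaleN1r addNr normr0 mulr0 => ?; lra.
by move=> Gr Gs; apply/eqP; rewrite eq_le !le.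
Qed.

(** The one-dimensional extension step. The value [c] at [v] has to satisfy
[r - C |x - v| <= c <= C |y + v| - s] for all [(x, r)] and [(y, s)] in the
graph. The triangle inequality for [x + y] makes these requirements compatible,
and the supremum of the left-hand sides meets them. Homogeneity reduces the
bound at [x + a v] to the cases [a = 1] and [a = -1]. *)
Lemma dominated_graph_extend G v : 0 <= C -> dominated_graph G -> G !=set0 ->
  exists c, dominated_graph
    [set z | exists x a, G x /\ z = (x.1 + a *: v, x.2 + a * c)].
Proof.
move=> C0 [Glin Gdom] [x0 Gx0].
have GZ a x : G x -> G (a *: x).
  move=> Gx; rewrite -[a *: x]addr0 -(addNr x) -scaleN1r.
  by apply: (Glin) => //; exact: (Glin).
pose S := [set x.2 - C * `|x.1 - v| | x in G].
have Sub x y : G x -> G y -> x.2 - C * `|x.1 - v| <= C * `|y.1 + v| - y.2.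
  move=> Gx Gy; have := Gdom _ (Glin 1 _ _ Gx Gy); rewrite scale1r /=.
  have := ler_wpM2l C0 (ler_normD (x.1 - v) (y.1 + v)).
  by rewrite addrACA addNr addr0 mulrDr => ? ?; lra.
have S0 : S !=set0 by exists (x0.2 - C * `|x0.1 - v|), x0.
have Sup : has_sup S.
  by split => //; exists (C * `|x0.1 + v| - x0.2) => _ [x Gx <-]; exact: Sub.
have supG x : G x -> x.2 - C * `|x.1 - v| <= sup S.
  by move=> Gx; apply: ub_le_sup; [case: Sup | exists x].
have supl y : G y -> sup S <= C * `|y.1 + v| - y.2.
  by move=> Gy; apply: ge_sup => // _ [x Gx <-]; exact: Sub.
exists (sup S); split.
  move=> k _ _ [x [a [Gx ->]]] [y [b [Gy ->]]].
  exists (k *: x + y), (k * a + b); split; first exact: Glin.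
  congr pair => /=.
    by rewrite scalerDr addrACA scalerDl scalerA.
  rewrite -[k *: (_ + _)]/(k * (x.2 + a * sup S)) -[k *: x.2]/(k * x.2); ring.
move=> _ [x [a [Gx ->]]] /=.
(* Divide by |a| and use the lower or the upper bound on sup S. *)
have [a0|a0|->] := ltgtP a 0; last by rewrite mul0r scale0r !addr0; exact: Gdom.
- have na : 0 < - a by rewrite oppr_gt0.
  have := supG _ (GZ (- a)^-1 _ Gx).
  rewrite /= -[(- a)^-1 *: x.2]/((- a)^-1 * x.2).
  rewrite -(ler_pM2l na) mulrBr mulVKf ?gt_eqF// mulrCA.
  rewrite -[X in C * (X * _)]ger0_norm ?(ltW na)// -normrZ scalerBr scalerA.
  by rewrite mulfV ?gt_eqF// scale1r scaleNr opprK => ?; lra.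
- have := supl _ (GZ a^-1 _ Gx).
  rewrite /= -[a^-1 *: x.2]/(a^-1 * x.2).
  rewrite -(ler_pM2l a0) mulrBr mulVKf ?gt_eqF// mulrCA.
  rewrite -[X in C * (X * _)]ger0_norm ?(ltW a0)// -normrZ scalerDr scalerA.
  by rewrite mulfV ?gt_eqF// scale1r => ?; lra.
Qed.

Lemma dominated_graph_max G0 : dominated_graph G0 ->
  exists G, [/\ dominated_graph G, G0 `<=` G &
    forall H, dominated_graph H -> G `<=` H -> H = G].
Proof.
move=> G0P.
(* The empty chain has the empty union, so the condition put to Zorn is on
   G0 `|` G, which makes the empty set admissible. *)
have [|G [GP Gmax]] := @Zorn_bigcup _ [set G | dominated_graph (G0 `|` G)].
  move=> F FP Ftot.
  have FP0 X : F X \/ X = set0 -> dominated_graph (G0 `|` X).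
    by move=> [/FP//|->]; rewrite setU0.
  have both x y : (G0 `|` \bigcup_(X in F) X) x -> (G0 `|` \bigcup_(X in F) X) y ->
      exists X, [/\ F X \/ X = set0, (G0 `|` X) x & (G0 `|` X) y].
    move=> [x0|[X FX Xx]] [y0|[Y FY Yy]].
    - by exists set0; split; [right|left|left].
    - by exists Y; split; [left|left|right].
    - by exists X; split; [left|right|left].
    - have [XY|YX] := Ftot _ _ FX FY.
      + by exists Y; split; [left|right; exact: XY|right].
      + by exists X; split; [left|right|right; exact: YX].
  have incl X : F X \/ X = set0 -> G0 `|` X `<=` G0 `|` \bigcup_(X in F) X.
    move=> [FX|->] z [z0|Xz]; [by left| |by left|by []].
    by right; exists X.
  split => [a x y Fx Fy|x Fx].
    have [X [FX Xx Xy]] := both _ _ Fx Fy; apply: (incl _ FX).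
    by have [+ _] := FP0 _ FX; exact.
  have [X [FX Xx _]] := both _ _ Fx Fx.
  by have [_ +] := FP0 _ FX; exact.
exists (G0 `|` G); split => // H HP GH; apply/seteqP; split => //.
have [GeqH|GneqH] := pselect (H = G); first by rewrite GeqH; right.
exfalso; apply: (Gmax H).
  rewrite properEneq; split; last by move=> z Gz; apply: GH; right.
  by apply/eqP => GH'; apply: GneqH.
by rewrite /= (_ : G0 `|` H = H)//; apply/setUidPr => z z0; apply: GH; left.
Qed.

End hahn_banach.
Arguments dominated_graph {R V}.

(** The form to be extended is given as [g] on the source of a linear map [T],
standing for the form [T w |-> g w] on the range of [T]; the bound makes the
latter well defined. *)
Lemma hahn_banach {R : realType} {V : normedModType R} {W : lmodType R}
    (T : {linear W -> V}) (g : {linear W -> R^o}) (C : R) : 0 <= C ->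
  (forall w, `|g w| <= C * `|T w|) ->
  exists F : {linear V -> R^o},
    (forall v, `|F v| <= C * `|v|) /\ (forall w, F (T w) = g w).
Proof.
move=> C0 gT; pose G0 : set (V * R^o) := range (fun w => (T w, g w)).
have G0P : dominated_graph C G0.
  split => [a _ _ [x _ <-] [y _ <-]|_ [w _ <-]].
    by exists (a *: x + y) => //; rewrite !linearP.
  exact: le_trans (ler_norm _) (gT w).
have [G [GP G0G Gmax]] := dominated_graph_max _ _ G0P.
have Gw w : G (T w, g w) by apply: G0G; exists w.
have G0n : G !=set0 by exists (T 0, g 0).
(* By maximality the one-dimensional extension adds nothing. *)
have dom v : exists r, G (v, r).
  have [c cP] := dominated_graph_extend C G v C0 GP G0n.
  exists c; rewrite -(Gmax _ cP) /=.
    exists (T 0, g 0), 1; split => //=.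
    by rewrite !linear0 !add0r scale1r mul1r.
  by move=> [x r] Gx; exists (x, r), 0; split => //=; rewrite scale0r mul0r !addr0.
pose F v := projT1 (cid (dom v)).
have GF v : G (v, F v) := projT2 (cid (dom v)).
have GE v r : G (v, r) -> F v = r.
  by move=> Gr; exact: (dominated_graph_fun _ _ _ _ _ GP (GF v) Gr).
have Flin : linear (F : V -> R^o).
  by move=> a x y; apply: GE; exact: (GP.1 a _ _ (GF x) (GF y)).
pose FL := GRing.isLinear.Build R V R^o *:%R F Flin.
pose F' : {linear V -> R^o} := HB.pack F FL.
exists F'; split => [v|w]; last exact: GE.
have [Glin Gdom] := GP.
have := Gdom _ (GF v); have := Gdom _ (GF (- v)).
have -> : F (- v) = - F v := linearN F' v.
by rewrite /= normrN => ? ?; rewrite ler_norml; apply/andP; split; lra.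
Qed.

(** For the converse direction, a continuous functional on [W] is moved to the
range of [T], where it has the same bound, and then extended to [V]. *)
Lemma weakly_cvg_isometry {R : realType} {W V : normedModType R}
    (T : {linear W -> V}) (u : nat -> W) (h : W) :
  (forall w, `|T w| = `|w|) ->
  weakly_cvg u h <-> weakly_cvg (T \o u) (T h).
Proof.
move=> Tiso; rewrite !weakly_cvgP; split => [uh f cf | Tuh g cg].
  apply: (uh (f \o T)) => w.
  apply: continuous_comp; last exact: cf.
  apply: bounded_linear_continuous; apply/linear_boundedP.
  by exists 1; split => // r /ltW r1 w'; rewrite Tiso ler_peMl.
have /linear_boundedP/pinfty_ex_gt0 [C C0 gC] := continuous_linear_bounded 0 (cg 0).
have [|F [FC FT]] := hahn_banach T g C (ltW C0).
  by move=> w; rewrite Tiso; exact: gC.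
have cF : continuous F.
  apply: bounded_linear_continuous; apply/linear_boundedP.
  exists C; split => [|r /ltW Cr v]; first exact: gtr0_real.
  by apply: le_trans (FC v) _; rewrite ler_wpM2r.
have -> : g \o u = F \o (T \o u) by apply/funext => n /=; rewrite FT.
by rewrite -FT; exact: Tuh.
Qed.

(** * Regularity of finite Borel measures *)

(** A closed set is the intersection of its neighborhoods of radius [1 / n]. *)
Lemma closed_Gdelta {R : realType} {X : pseudoMetricType R} (A : set X) :
  closed A -> Gdelta A.
Proof.
move=> cA; exists (fun n => (\bigcup_(x in A) ball x n.+1%:R^-1)^°).
  by move=> n; exact: open_interior.
apply/seteqP; split => [x Ax n _|x Ux].
  have : nbhs x (ball x (n.+1%:R^-1 : R)) by apply: nbhsx_ballx; rewrite invr_gt0.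
  by apply: filterS => y xy; exists x.
apply: cA => B /nbhs_ballP[e /= e0 eB].
have [n ne] : exists n : nat, n.+1%:R^-1 < e.
  by have := @near_infty_natSinv_lt R (PosNum e0) => -[n _ /(_ n (leqnn n))]; exists n.
have /interior_subset [y Ay yx] := Ux n I.
exists y; split => //; apply: eB; apply: ball_sym.
exact: le_ball (ltW ne) _ yx.
Qed.

Lemma nonincreasing_measure_lt {R : realType} {d} {T : measurableType d}
    (nu : {finite_measure set T -> \bar R}) (F : (set T)^nat) (e : \bar R) :
  (forall n, measurable (F n)) -> nonincreasing_seq F ->
  (nu (\bigcap_n F n) < e)%E -> exists n, (nu (F n) < e)%E.
Proof.
move=> mF niF nuFe; apply: contrapT => /forallNP Fe.
have Fcvg : nu \o F @ \oo --> nu (\bigcap_n F n).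
  apply: nonincreasing_cvg_mu => //.
  - by rewrite -ge0_fin_numE// fin_num_measure.
  - by apply: bigcapT_measurable.
have : (e <= lim (nu \o F @ \oo))%E.
  apply: lime_ge; first by apply/cvg_ex; eexists; exact: Fcvg.
  by apply: nearW => n; rewrite leNgt; apply/negP; exact: Fe.
by rewrite (cvg_lim _ Fcvg)// leNgt nuFe.
Qed.

Section regularity.
Context {R : realType} {X : ptopologicalType}.
Context (nu : {finite_measure set (borel X) -> \bar R}).

(** The Borel sets with this property form a sigma-algebra, which is how
regularity is obtained. *)
Definition tight_approx (A : set X) := forall e : R, 0 < e ->
  exists F G : set X, [/\ closed F, open G, F `<=` A, A `<=` G &
    (nu (G `\` F) < e%:E)%E].

(** A closed set is its own inner approximation; the finite intersections of the
open sets cutting it out decrease to it, hence so do their measures. *)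
Lemma tight_approx_closed A : Gdelta A -> closed A -> tight_approx A.
Proof.
move=> [U oU AU] cA e e0.
pose G n := \bigcap_(i < n) U i.
have oG n : open (G n).
  rewrite /G bigcap_mkord; elim/big_ind : _ => // [|? ?].
    exact: openT.
  exact: openI.
have AG n : A `<=` G n by rewrite AU => x Ux i _; exact: Ux.
have capG : \bigcap_n (G n `\` A) = set0.
  apply/seteqP; split => // x GAx; have [_ +] := GAx 0%N I; apply.
  rewrite AU => n _; have [+ _] := GAx n.+1 I; apply => /=; exact: ltnSn.
have [n nune] : exists n, (nu (G n `\` A) < e%:E)%E.
  apply: nonincreasing_measure_lt.
  - by move=> n; apply: measurableD; [exact: borel_open|exact: borel_closed].
  - move=> m n mn; apply/subsetPset; apply: setSD => x Gx i /= im.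
    by apply: Gx => /=; exact: leq_trans im mn.
  - by rewrite capG measure0 lte_fin.
by exists A, (G n); split.
Qed.

Lemma tight_approxC A : tight_approx A -> tight_approx (~` A).
Proof.
move=> tA e e0; have [F [G [cF oG FA AG nue]]] := tA e e0.
exists (~` G), (~` F); split.
- exact: open_closedC.
- exact: closed_openC.
- exact: subsetC.
- exact: subsetC.
- by rewrite setDE setCK setIC -setDE.
Qed.

(** The outer approximations are united, with errors summing to at most [e / 2].
A countable union of closed sets need not be closed, so only finitely many inner
approximations are kept; continuity from above bounds what is lost. *)
Lemma tight_approx_bigcup (A : (set X)^nat) :
  (forall n, tight_approx (A n)) -> tight_approx (\bigcup_n A n).
Proof.
move=> tA e e0.
have e20 : 0 < e / 2 by rewrite divr_gt0.
have : forall n, exists FG : set X * set X, [/\ closed FG.1, open FG.2,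
    FG.1 `<=` A n, A n `<=` FG.2 &
    (nu (FG.2 `\` FG.1) < (e / 2 / (2 ^ n.+1)%:R)%:E)%E].
  move=> n; have [|F [G [? ? ? ? ?]]] := tA n (e / 2 / (2 ^ n.+1)%:R).
    by rewrite divr_gt0// ltr0n expn_gt0.
  by exists (F, G).
move=> /choice[FG FGP].
pose F n := (FG n).1; pose G n := (FG n).2.
have cF n : closed (F n) by have [] := FGP n.
have oG n : open (G n) by have [] := FGP n.
have oUG : open (\bigcup_n G n) by exact: bigcup_open.
have mF n : measurable (F n : set (borel X)) by exact: borel_closed.
have mG n : measurable (G n : set (borel X)) by exact: borel_open.
have mGF n : measurable (G n `\` F n : set (borel X)) by exact: measurableD.
have cUF n : closed (\bigcup_(i < n) F i).
  by apply: closed_bigcup => // ; exact: finite_II.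
have Ufin : (nu ((\bigcup_n G n) `\` \bigcup_n F n) < e%:E)%E.
  apply: (@le_lt_trans _ _ (e / 2)%:E); last by rewrite lte_fin; lra.
  apply: (@le_trans _ _ (\sum_(n <oo) nu (G n `\` F n))%E).
    apply: measure_sigma_subadditive => //.
      by apply: measurableD; [exact: borel_open|exact: bigcup_measurable].
    move=> x [[n _ Gx] Fx]; exists n => //; split => // Fnx.
    by apply: Fx; exists n.
  apply: le_trans (epsilon_trick0 xpredT (ltW e20)).
  by apply: lee_nneseries => // n _; have [_ _ _ _ /ltW] := FGP n.
have [n nune] : exists n, (nu ((\bigcup_n G n) `\` \bigcup_(i < n) F i) < e%:E)%E.
  apply: nonincreasing_measure_lt.
  - by move=> n; apply: measurableD; [exact: borel_open|exact: borel_closed].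
  - move=> m n mn; apply/subsetPset; apply: setDS => x [i /= im Fx].
    by exists i => //=; exact: leq_trans mn.
  - rewrite (_ : \bigcap_n _ = (\bigcup_n G n) `\` \bigcup_n F n)//.
    apply/seteqP; split => [x GFx|x [Gx Fx] n _].
      split; first by have [] := GFx 0%N I.
      by move=> [i _ Fx]; have [_ +] := GFx i.+1 I; apply; exists i => //=.
    by split => // -[i _ Fix]; apply: Fx; exists i.
exists (\bigcup_(i < n) F i), (\bigcup_n G n); split => //.
- by move=> x [i _ Fx]; exists i => //; have [_ _ + _ _] := FGP i; exact.
- by move=> x [i _ Ax]; exists i => //; have [_ _ _ + _] := FGP i; exact.
Qed.

Lemma tight_approx_borel : (forall A : set X, closed A -> Gdelta A) ->
  forall A : set (borel X), measurable A -> tight_approx A.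
Proof.
move=> closedG; apply: smallest_sub => [|U oU].
  split.
  - by apply: tight_approx_closed; [apply: closedG|]; exact: closed0.
  - by move=> A tA; rewrite setTD; exact: tight_approxC.
  - exact: tight_approx_bigcup.
rewrite -[U]setCK; apply: tight_approxC.
by apply: tight_approx_closed; [apply: closedG|]; exact: open_closedC.
Qed.

End regularity.

(** The variation of a charge is a finite measure that bounds the charge on every
Borel subset of [G `\` F], so regularity follows from the case of measures. *)
Lemma regular_charge {R : realType} {X : ptopologicalType}
    (closedG : forall A : set X, closed A -> Gdelta A)
    (nu : {charge set (borel X) -> \bar R}) :
  regular (fun A => fine (nu A)).
Proof.
have [P [N PN]] := Hahn_decomposition nu.
pose v := charge_variation PN.
pose vfin := Measure_isFinite.Build _ _ _ v (@fin_num_measure _ _ _ v).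
pose v' : {finite_measure set (borel X) -> \bar R} := HB.pack v vfin.
move=> A mA e e0.
have [F [G [cF oG FA AG ve]]] := tight_approx_borel v' closedG A mA e e0.
exists F, G; split => // C mC CGF.
have mGF : measurable (G `\` F : set (borel X)).
  by apply: measurableD; [exact: borel_open|exact: borel_closed].
rewrite -lte_fin; apply: le_lt_trans ve.
apply: (@le_trans _ _ (v C)); last by rewrite le_measure// inE.
apply: le_trans (abse_charge_variation PN mC).
by rewrite -[X in (_ <= `|X|)%E]fineK// fin_num_measure.
Qed.

(** * Measures with a density *)

Lemma L1_integrable {d} {T : measurableType d} {R : realType}
    {mu : {measure set T -> \bar R}} (w : LspaceType1 mu) :
  mu.-integrable setT (EFin \o w).
Proof. exact/Lfun1_integrable/L1_in. Qed.

Lemma L1_integrableS {d} {T : measurableType d} {R : realType}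
    {mu : {measure set T -> \bar R}} (w : LspaceType1 mu) A : measurable A ->
  mu.-integrable A (EFin \o w).
Proof. by move=> mA; apply: integrableS (L1_integrable w). Qed.

Lemma L1_normE {d} {T : measurableType d} {R : realType}
    {mu : {measure set T -> \bar R}} (w : LspaceType1 mu) :
  `|w| = \int[mu]_x `|w x|.
Proof. by rewrite -[LHS]/(L1_norm w) /L1_norm Lnorm1. Qed.

Section rca_of_density.
Context {R : realType} {X : ptopologicalType}.
Context (closedG : forall A : set X, closed A -> Gdelta A).
Context (mu : {measure set (borel X) -> \bar R}).
Implicit Type w : LspaceType1 mu.

(** The value [0] off the Borel sets is the normalization built into [rca]. *)
Definition density_fun w (A : set (borel X)) : R :=
  if asbool (measurable A) then \int[mu]_(x in A) w x else 0.

Lemma density_fun_measurable w A : measurable A ->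
  density_fun w A = \int[mu]_(x in A) w x.
Proof. by move=> mA; rewrite /density_fun asboolT. Qed.

Lemma density_fun_rca w : density_fun w \in @is_rca R X.
Proof.
pose nu : {charge set (borel X) -> \bar R} := induced_charge (L1_integrable w).
have nuE A : measurable A -> (density_fun w A)%:E = nu A.
  move=> mA; rewrite density_fun_measurable// fineK//.
  by apply: integrable_fin_num => //; exact: L1_integrableS.
rewrite inE; split.
- by move=> A mA; rewrite /density_fun asboolF.
- by rewrite density_fun_measurable// Rintegral_set0.
- move=> F mF tF mUF; rewrite nuE//.
  under eq_fun do under eq_bigr do rewrite nuE//.
  exact: (@charge_semi_sigma_additive _ _ _ nu).
- move=> A mA e e0; have [F [G [? ? ? ? FGe]]] := regular_charge closedG nu A mA e e0.
  exists F, G; split => // C mC /(FGe _ mC).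
  by rewrite density_fun_measurable.
Qed.

Definition rca_of_density w : rca R X := Rca (density_fun_rca w).

Lemma rca_of_densityE w A : measurable A ->
  rca_of_density w A = \int[mu]_(x in A) w x.
Proof. exact: density_fun_measurable. Qed.

Lemma eq_rca (m1 m2 : rca R X) : (forall A, measurable A -> m1 A = m2 A) -> m1 = m2.
Proof.
move=> m12; apply/val_inj/funext => A.
have [mA|nA] := pselect (measurable A); first exact: m12.
by have [n1 _ _ _] := rcaP m1; have [n2 _ _ _] := rcaP m2; rewrite /= n1// n2.
Qed.

Lemma has_densityP (m : rca R X) w : has_density mu m w <-> m = rca_of_density w.
Proof.
have fin A : measurable A ->
    (rca_of_density w A)%:E = (\int[mu]_(x in A) (w x)%:E)%E.
  move=> mA; rewrite rca_of_densityE// fineK//.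
  by apply: integrable_fin_num => //; exact: L1_integrableS.
split => [mw|-> A mA]; last exact: fin.
by apply: eq_rca => A mA; apply: EFin_inj; rewrite mw// fin.
Qed.

Lemma rca_of_density_linear : linear rca_of_density.
Proof.
move=> a v w; apply: eq_rca => A mA.
rewrite -[RHS]/(a * rca_of_density v A + rca_of_density w A) !rca_of_densityE//.
have vA := L1_integrableS v _ mA; have wA := L1_integrableS w _ mA.
rewrite -RintegralZl// -RintegralD//; last exact: (integrableZl mA a vA).
congr fine; apply: ae_eq_integral => //.
- apply/measurable_EFinP; exact/measurable_funTS/L1_measurable.
- apply/measurable_EFinP/measurable_funD.
    by apply: measurable_funM => //; exact/measurable_funTS/L1_measurable.
  exact/measurable_funTS/L1_measurable.
- move: (L1_addE (a *: v) w) (L1_scaleE a v); apply: filterS2 => x h1 h2 _.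
  by rewrite [X in X%:E = _](h1 I) [X in (X + _)%:E = _](h2 I).
Qed.

HB.instance Definition _ := GRing.isLinear.Build R (LspaceType1 mu) (rca R X)
  *:%R rca_of_density rca_of_density_linear.

Lemma Rintegral_normr_setU w (A B : set (borel X)) :
  measurable A -> measurable B -> A `|` B = setT -> A `&` B = set0 ->
  `|w| = \int[mu]_(x in A) `|w x| + \int[mu]_(x in B) `|w x|.
Proof.
move=> mA mB AB AB0; rewrite L1_normE -AB Rintegral_setU//.
  by rewrite AB; exact: (integrable_norm (L1_integrable w)).
by apply/disj_setPS; rewrite AB0.
Qed.

(** The total variation is attained on the two parts of a Hahn decomposition,
where the triangle inequality for integrals gives one bound. The partition of
the space by the sign of [w] turns it into an equality. *)
Lemma rca_of_density_isometry w : `|rca_of_density w| = `|w|.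
Proof.
apply/eqP; rewrite eq_le; apply/andP; split.
- rewrite -[`|rca_of_density w|]/(rca_norm _).
  have [A [B [mA mB AB AB0 ->]]] := rca_normE (rca_of_density w).
  rewrite (Rintegral_normr_setU w _ _ mA mB AB AB0) !rca_of_densityE//.
  apply: le_trans (lerD (le_normr_Rintegral mA (L1_integrableS w _ mA))
                       (le_normr_Rintegral mB (L1_integrableS w _ mB))).
  by apply: le_trans (ler_norm _) _; exact: ler_normB.
- pose A := [set x | 0 <= w x]; pose B := [set x | w x < 0].
  have mA : measurable A.
    rewrite -[A]setTI; apply: (@measurable_fun_ler _ _ _ _ (cst 0)) => //.
    exact: L1_measurable.
  have mB : measurable B.
    rewrite -[B]setTI; apply: (@measurable_fun_ltr _ _ _ _ _ (cst 0)) => //.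
    exact: L1_measurable.
  have AB : A `|` B = setT.
    by apply/seteqP; split => // x _; case: (leP 0 (w x)); [left|right].
  have AB0 : A `&` B = set0.
    by apply/seteqP; split => // x [/le_lt_trans A0 /A0]; rewrite ltxx.
  rewrite (Rintegral_normr_setU w _ _ mA mB AB AB0).
  apply: le_trans (Defs.total_variationD (rca_of_density w) mA mB AB AB0).
  rewrite !rca_of_densityE//; apply: lerD.
    rewrite (@eq_Rintegral _ _ _ mu A w) ?ler_norm// => x; rewrite inE => /= w0.
    exact: ger0_norm.
  rewrite (@eq_Rintegral _ _ _ mu B (fun x => -1 * w x)).
    rewrite RintegralZl//; last exact: L1_integrableS.
    by rewrite mulN1r -normrN ler_norm.
  by move=> x; rewrite inE => /= w0; rewrite mulN1r ltr0_norm.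
Qed.

End rca_of_density.

(** * Probability measures and weak limits *)

Section rca_probability.
Context {R : realType} {X : ptopologicalType}.
Implicit Type m : rca R X.

Lemma is_probabilityP m : is_probability m <->
  (forall A, measurable A -> 0 <= m A) /\ m setT = 1.
Proof.
split => [[P mP]|[m0 m1]].
  split => [A mA|]; first by rewrite -lee_fin mP.
  by apply: EFin_inj; rewrite mP// probability_setT.
have pos A : (0 <= rca_charge m A)%E.
  rewrite lee_fin; have [/m0//|nA] := pselect (measurable A).
  by have [n0 _ _ _] := rcaP m; rewrite n0.
pose P := measure_of_charge (rca_charge m) pos.
have P1 : P setT = 1%E by rewrite /P /measure_of_charge /rca_charge m1.
pose P1m := Measure_isProbability.Build _ _ _ P P1.
by exists (HB.pack P P1m : probability _ _).
Qed.

(** The codomain [R^o] carries the module structure used for linear forms. *)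
Definition rca_eval (A : set (borel X)) m : R^o := m A.

Lemma rca_eval_linear A : linear (rca_eval A).
Proof. by []. Qed.

HB.instance Definition _ A :=
  GRing.isLinear.Build R (rca R X) R^o *:%R (rca_eval A) (rca_eval_linear A).

Lemma rca_eval_continuous A : measurable A -> continuous (rca_eval A).
Proof.
move=> mA; apply: bounded_linear_continuous; apply/linear_boundedP.
exists 1; split => // r /ltW r1 m; apply: (@le_trans _ _ `|m|); last first.
  by rewrite ler_peMl.
rewrite -[`|m|]/(rca_norm m) -lee_fin /rca_norm.
rewrite fineK; last exact: total_variation_fin.
apply: le_trans (le_total_variation m mA) _.
by rewrite le_measure ?inE.
Qed.

Lemma weakly_cvg_rca_eval (rho : nat -> rca R X) (eta : rca R X) A :
  weakly_cvg rho eta -> measurable A -> (fun n => rho n A) @ \oo --> eta A.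
Proof. by move=> /weakly_cvgP + mA => /(_ (rca_eval A) (rca_eval_continuous A mA)). Qed.

(** Each condition characterizing probabilities concerns the value at one Borel
set, and weak convergence implies convergence of these values. *)
Lemma weakly_cvg_is_probability (rho : nat -> rca R X) (eta : rca R X) :
  weakly_cvg rho eta -> (forall n, is_probability (rho n)) -> is_probability eta.
Proof.
move=> rhoeta rhoP; apply/is_probabilityP; split => [A mA|].
  rewrite -(cvg_lim _ (weakly_cvg_rca_eval _ _ _ rhoeta mA))//.
  apply: limr_ge; first by apply/cvg_ex; exists (eta A); exact: weakly_cvg_rca_eval.
  by apply: nearW => n; have /is_probabilityP[+ _] := rhoP n; exact.
rewrite -(cvg_lim _ (weakly_cvg_rca_eval _ _ _ rhoeta measurableT))//.
rewrite (_ : (fun n => _) = cst 1) ?lim_cst//.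
by apply/funext => n; have /is_probabilityP[] := rhoP n.
Qed.

(** A point of [Omega] serves to read off the common value. Conversely, a constant
map is weak-star measurable and bounded, whatever its value. *)
Lemma homogeneous_young_measureP {d : nat} (Omega : set 'rV[R]_d) (m : rca R X) :
  Omega !=set0 -> homogeneous_young_measure Omega m <-> is_probability m.
Proof.
move=> [w0 Ow0]; split => [[nu [[_ _ nuP] num]]|mP].
  by rewrite -(num _ Ow0); exact: nuP.
exists (cst m); split; last by [].
split; last by [].
  by move=> f _; exact: (@measurable_cst _ _ _ _ _ (rca_integral f m)).
by exists `|m|; apply: (@aeW _ (borel _) _ (lebesgue_rV R d)) => w _; exact: lexx.
Qed.

End rca_probability.

(** * Densities of homogeneous Young measures *)

Theorem corollary4p3 (R : realType) (d l : nat)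
  (Omega : set 'rV[R]_d) (Omega0 : Omega !=set0) (Omega_open : open Omega)
  (Omega_bounded : bounded_set Omega)
  (K : set 'rV[R]_l) (cK : compact K) (K0 : K !=set0)
  (rho : nat -> rca R (compact_space cK K0))
  (u : nat -> LspaceType1 (lebesgue_on cK K0))
  (rho_young : forall n, homogeneous_young_measure Omega (rho n))
  (rho_cont : forall n, mu_continuous (lebesgue_on cK K0) (rho n))
  (rho_density : forall n, has_density (lebesgue_on cK K0) (rho n) (u n))
  (h : LspaceType1 (lebesgue_on cK K0)) :
  weakly_cvg u h <->
  exists eta : rca R (compact_space cK K0),
    [/\ homogeneous_young_measure Omega eta,
        has_density (lebesgue_on cK K0) eta h &
        weakly_cvg rho eta].
Proof.
have closedG : forall A : set (compact_space cK K0), closed A -> Gdelta A.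
  exact: (@closed_Gdelta R (set_type K : pseudoMetricType R)).
pose T := rca_of_density closedG (lebesgue_on cK K0).
have rhoE : rho = T \o u.
  by apply/funext => n; exact/has_densityP.
have uh : weakly_cvg u h <-> weakly_cvg rho (T h).
  rewrite rhoE; exact: (weakly_cvg_isometry T _ _ (rca_of_density_isometry _ _)).
rewrite uh; split => [rhoh|[eta [_ /(has_densityP closedG) -> //]]].
exists (T h); split => //; last exact/has_densityP.
apply/(homogeneous_young_measureP Omega _ Omega0).
apply: weakly_cvg_is_probability rhoh _ => n.
exact/(homogeneous_young_measureP Omega _ Omega0).
Qed.
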